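(* Let $X_1,X_2,\dots$ be independent identically distributed random variables taking positive integer values, and let $W_n=\sum_{i=1}^n X_i$ for $n\ge1$. Let $s_1,s_2,\dots$ (a finite or infinite list) be the distinct values taken by $X_1$ with positive probability, and let $p_i=P(X_1=s_i)>0$. Put $$\theta=\inf_{i}\frac{-\log p_i}{s_i}\ \ge 0 .$$ If the moment generating function $M(t)=E\left[e^{tX_1}\right]$ has radius of convergence larger than $2\theta$, then for any fixed integer $m\ge2$, with probability $1$ the sequence $W_1,W_2,\dots$ is asymptotically $m$-complete.
   Context: For a positive integer $m$, a non-decreasing sequence of positive integers $a_1\le a_2\le\dots$ with $d=\gcd(a_1,a_2,\dots)$ is called asymptotically $m$-complete if there is a positive integer $n_0$ such that for every integer $n\ge n_0$ the integer $nd$ is a sum of exactly $m$ index-distinct terms, i.e. $nd=a_{i_1}+\dots+a_{i_m}$ for some $i_1<\dots<i_m$. (The paper writes $\theta$ as $\frac{-\log p_*}{s_*}$.) *)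

(* Defs.v *)
From mathcomp Require Import all_boot all_order all_algebra.
From mathcomp Require Import finmap.
From mathcomp Require Import all_classical all_reals all_analysis.

Set Implicit Arguments.
Unset Strict Implicit.
Unset Printing Implicit Defensive.

Import Order.TTheory GRing.Theory Num.Theory.

Local Open Scope classical_set_scope.
Local Open Scope ring_scope.

Definition is_gcd_seq (a : nat -> nat) (d : nat) : Prop :=
  (forall i, (d %| a i)%N) /\
  (forall e : nat, (forall i, (e %| a i)%N) -> (e %| d)%N).

(* The sequence is indexed from 0: [a i] is the term a_{i+1}. *)
Definition asymptotically_complete (m : nat) (a : nat -> nat) : Prop :=
  [/\ forall i, (0 < a i)%N,
      forall i j, (i <= j)%N -> (a i <= a j)%N &
      exists d : nat, is_gcd_seq a d /\
        exists2 n0 : nat, (0 < n0)%N &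
          forall n : nat, (n0 <= n)%N ->
            exists2 f : 'I_m -> nat,
              forall j k : 'I_m, (j < k)%N -> (f j < f k)%N &
              (n * d = \sum_(j < m) a (f j))%N].

Definition mutually_independent (d d' : measure_display)
    (T : measurableType d) (T' : measurableType d') (R : realType)
    (P : probability T R) (X : nat -> {RV P >-> T'}) : Prop :=
  forall (J : {fset nat}) (A : nat -> set T'),
    (forall i, measurable (A i)) ->
    P (\bigcap_(i in [set` J]) (X i @^-1` A i)) =
      (\prod_(i <- J) P (X i @^-1` A i))%E.

Definition identically_distributed (d d' : measure_display)
    (T : measurableType d) (T' : measurableType d') (R : realType)
    (P : probability T R) (X : nat -> {RV P >-> T'}) : Prop :=
  forall (i j : nat) (A : set T'), measurable A ->
    distribution P (X i) A = distribution P (X j) A.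

Definition partial_sum (T : Type) (X : nat -> T -> nat) (n : nat) (w : T) : nat :=
  (\sum_(i < n) X i w)%N.

Section OneVariable.
Context (d : measure_display) (T : measurableType d) (R : realType).
Variable P : probability T R.

Definition theta (X : {RV P >-> nat}) : R :=
  inf [set - ln (fine (distribution P X [set s])) / s%:R
      | s in [set s : nat | (0 < distribution P X [set s])%E]].

Definition mgf (X : {RV P >-> nat}) (t : R) : \bar R :=
  ('M_P (fun w => (X w)%:R)) t.

(* Largest r such that E[e^{tX}] converges for |t| < r; 0 if it diverges
   arbitrarily close to 0, +oo if it converges everywhere. *)
Definition mgf_radius (X : {RV P >-> nat}) : \bar R :=
  ereal_sup [set r%:E | r in
    [set r : R | 0 <= r /\ forall t : R, `|t| < r -> (mgf X t < +oo)%E]].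

End OneVariable.

(* Main.v *)
Require Import Defs.
From mathcomp Require Import all_boot all_order all_algebra.
From mathcomp Require Import finmap.
From mathcomp Require Import all_classical all_reals all_analysis.
From mathcomp Require Import zify ring lra.

Set Implicit Arguments.
Unset Strict Implicit.
Unset Printing Implicit Defensive.

Import Order.TTheory GRing.Theory Num.Theory.

Local Open Scope classical_set_scope.
Local Open Scope ring_scope.

(** Write [p s] for the law of a step and [W n] for the [n]-th partial sum.  The
case [m = 2] carries everything: almost surely, for every large multiple [tau]
of the gcd [g] of the support, [tau = W i + W j] with [k <= i < j], where [k] is
any fixed index.  For [m = k + 1] terms, add the first [m - 2] terms of the
sequence to such a pair; and since a common divisor of the sequence divides two
consecutive multiples of [g], the gcd of the sequence is exactly [g]
([complete_of_pairs]).

Fix [t > 2 * theta] with [M(t)] finite, put [a = e^(t/2)], and choose a value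
[s] with [p s = rho ^- s] where [1 <= rho < a]; such an [s] exists because
[theta] is an infimum below [t / 2] ([exponential_rates]).  Two facts follow.
Steps longer than [l] have probability [O(a ^- (2 * l))].  Every large multiple
[y] of [g] is the length of some path of probability at least
[kap * rho ^- y]: repeat the step [s], and correct the residue modulo [s] by
boundedly many other steps ([likely_paths]).

Let [a ^ l <= tau < a ^ (l + 1)] and suppose that none of the first [O(tau)]
steps exceeds [l].  Reveal the first [N] steps, with [N] so small that [W N] is
below [tau / 2].  The pair exists if the walk, continued from [W N], hits the
set [B] of the numbers [tau - W i], [k <= i < N]; and [B] has gaps of length at
most [l].  From any position [x] there is thus a point of [B] at distance
between [y0] and [y0 + l], and the walk hits it with probability at least
[eps = kap * rho ^- (y0 + l)]; if it fails, it is at most [l] beyond that point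
and a new attempt starts.  The walk makes as many attempts as there are stages
of length [y0 + 2 * l] in the range of [B], so it avoids [B] with probability
at most [(1 - eps) ^ I] for [I] stages ([avoid_mass_stages],
[pair_free_mass]).  About [l * rho ^ l] stages bring this below
[a ^- (2 * l)], and they fit below [tau >= a ^ l] because [rho < a]
([stage_count]).

Only [O(a ^ l)] targets [tau] and [O(a ^ l)] steps belong to this [l], so one of
these targets is missed with probability [O(a ^- l)] ([missed_prob]).  This is
summable in [l], and Borel-Cantelli ([ae_eventually_not]) concludes.

The conditioning on the revealed steps is done on finite sums: [path_mass] is
the total weight of the step sequences with a given property, [avoid_mass] the
weight of those that stay off a set, and independence enters only through the
probabilities of cylinders ([cylinder_prob], [prob_le_path]). *)

(** * Paths of probability at least exponential in their length *)

(** The least positive difference of two sums of elements of [S] divides every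
    [x] in [S]: otherwise [x %% g] would be a smaller such difference. *)
Lemma gcd_as_difference (S : pred nat) s : S s -> (0 < s)%N ->
  exists g : nat, [/\ (0 < g)%N, forall x, S x -> (g %| x)%N &
    exists la lb : seq nat,
      [/\ all S la, all S lb & (sumn la = sumn lb + g)%N]].
Proof.
move=> Ss s_gt0.
pose difference g := (0 < g)%N /\ exists la lb : seq nat,
  [/\ all S la, all S lb & (sumn la = sumn lb + g)%N].
have sumn_copies (q : nat) (l : seq nat) :
    all S l -> exists2 l', all S l' & sumn l' = (q * sumn l)%N.
  move=> Sl; exists (flatten (nseq q l)).
    by elim: q => //= q IH; rewrite all_cat Sl.
  by elim: q => //= q IH; rewrite sumn_cat IH mulSn.
have ex_diff : exists g, `[< difference g >].
  exists s; apply/asboolP; split=> //; exists [:: s], [::].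
  by rewrite /= Ss addn0.
case: (ex_minnP ex_diff) => g /asboolP[g_gt0 [la [lb [Sla Slb eg]]]] g_min.
exists g; split=> //; last by exists la, lb.
move=> x Sx; rewrite /dvdn; case: posnP => // r_gt0.
have [xb Sxb exb] := sumn_copies (x %/ g)%N lb Slb.
have [xa Sxa exa] := sumn_copies (x %/ g)%N la Sla.
(* x + q * sumn lb = x %% g + q * sumn la, with q the quotient of x by g *)
have : difference (x %% g)%N.
  split=> //; exists (x :: xb), xa; rewrite /= Sx; split=> //.
  by rewrite exb exa eg {1}(divn_eq x g) mulnDr; lia.
by move/asboolP/g_min; rewrite leqNgt ltn_pmod.
Qed.

Section LikelyPaths.
Context (R : realFieldType) (p : nat -> R).
Hypothesis p_ge0 : forall s, 0 <= p s.
Hypothesis p_le1 : forall s, p s <= 1.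
Hypothesis p0 : p 0%N = 0.

(** A multiple [y] of [g] is reached by [i] copies of a list [la], [s - 1 - i]
    copies of a list [lb] and some copies of [s], where
    [sumn la = sumn lb + g]: varying [i] below [s] gives all the multiples of
    [g] modulo [s].  The copies of [s] have weight at least [rho ^- y], the
    others at least a constant. *)
Lemma likely_paths (rho : R) (s : nat) : 1 <= rho -> 1 <= p s * rho ^+ s ->
  exists (g y0 L0 : nat) (kap : R),
  [/\ (0 < g)%N, forall x, 0 < p x -> (g %| x)%N, 0 < kap <= 1 &
      forall y, (y0 <= y)%N -> (g %| y)%N ->
      exists l : seq nat,
        [/\ sumn l = y, all (fun x => (0 < p x) && (x <= L0)%N) l &
            kap <= (\prod_(x <- l) p x) * rho ^+ y]].
Proof.
move=> rho_ge1 ps_rho.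
have rho_gt0 : 0 < rho by apply: lt_le_trans rho_ge1.
have ps_gt0 : 0 < p s.
  rewrite lt_def p_ge0 andbT; apply/eqP => ps0.
  by move: ps_rho; rewrite ps0 mul0r ler10.
have s_gt0 : (0 < s)%N.
  by case: s ps_gt0 {ps_rho} => //; rewrite p0 ltxx.
have [g [g_gt0 g_dvd [la [lb [Sla Slb eg]]]]] :=
  @gcd_as_difference (fun x => 0 < p x) s ps_gt0 s_gt0.
have prod_gt0 l : all (fun x => 0 < p x) l -> 0 < \prod_(x <- l) p x.
  elim: l => [|x l IH] /=; first by rewrite big_nil.
  by case/andP=> px /IH; rewrite big_cons; exact: mulr_gt0.
have prod_le1 l : \prod_(x <- l) p x <= 1.
  elim: l => [|x l IH]; first by rewrite big_nil.
  by rewrite big_cons mulr_ile1 // prodr_ge0.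
pose A := \prod_(x <- la) p x; pose B := \prod_(x <- lb) p x.
have A_gt0 : 0 < A by exact: prod_gt0.
have B_gt0 : 0 < B by exact: prod_gt0.
have A_le1 : A <= 1 by exact: prod_le1.
have B_le1 : B <= 1 by exact: prod_le1.
pose L0 := \max_(x <- s :: la ++ lb) x.
have L0_max (x : nat) : x \in s :: la ++ lb -> (x <= L0)%N.
  by move=> xin; apply: (@leq_bigmax_seq _ _ xpredT id).
exists g, (s.-1 * sumn lb)%N, L0, ((A * B) ^+ s); split=> //.
  have AB_ge0 : 0 <= A * B by rewrite ltW // mulr_gt0.
  by rewrite exprn_gt0 ?mulr_gt0 //= exprn_ile1 // mulr_ile1 // ltW.
move=> y y0y gy.
pose z := (y - s.-1 * sumn lb)%N.
have dvd_sumn l : all (fun x => 0 < p x) l -> (g %| sumn l)%N.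
  elim: l => [|x l IH] /=; first by rewrite dvdn0.
  by case/andP=> /g_dvd gx /IH; exact: dvdn_add.
have gz : (g %| z)%N by rewrite dvdn_sub // dvdn_mull // dvd_sumn.
have gr : (g %| z %% s)%N.
  by rewrite -(dvdn_addr _ (dvdn_mull (z %/ s)%N (g_dvd s ps_gt0))) -divn_eq.
pose i := (z %% s %/ g)%N; pose j := (z %/ s)%N.
have ei : (i * g = z %% s)%N by rewrite /i divnK.
have i_lt : (i < s)%N.
  apply: leq_ltn_trans (ltn_pmod z s_gt0); rewrite -ei; exact: leq_pmulr.
have i_le : (i <= s.-1)%N by rewrite -ltnS prednK.
have y_eq : (j * s + i * sumn la + (s.-1 - i) * sumn lb = y)%N.
  have zeq := divn_eq z s; rewrite -/j -ei in zeq.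
  have copies : (i * sumn lb + (s.-1 - i) * sumn lb = s.-1 * sumn lb)%N.
    by rewrite -mulnDl subnKC.
  rewrite eg mulnDr -[RHS](subnKC y0y) -/z zeq -copies.
  by rewrite addnA -addnA [RHS]addnC addnACA !addnA.
exists (nseq j s ++ flatten (nseq i la) ++ flatten (nseq (s.-1 - i) lb)).
have all_copies (q : pred nat) n l : all q l -> all q (flatten (nseq n l)).
  by move=> ql; elim: n => //= n IH; rewrite all_cat ql.
have sumn_copies n l : sumn (flatten (nseq n l)) = (n * sumn l)%N.
  by elim: n => //= n IH; rewrite sumn_cat IH mulSn.
have prod_copies n l :
    \prod_(x <- flatten (nseq n l)) p x = (\prod_(x <- l) p x) ^+ n.
  by elim: n => [|n IH] /=; rewrite ?big_nil // big_cat IH exprS.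
have bounded l : {subset l <= s :: la ++ lb} -> all (fun x => 0 < p x) l ->
    all (fun x => (0 < p x) && (x <= L0)%N) l.
  move=> ls /allP lp; apply/allP => x xl.
  by rewrite lp //= L0_max // ls.
split.
- by rewrite !sumn_cat !sumn_copies sumn_nseq -[RHS]y_eq !addnA mulnC.
- rewrite !all_cat !all_copies ?andbT //.
  + by rewrite all_nseq ps_gt0 L0_max ?inE ?eqxx ?orbT.
  + by apply: bounded => // x xl; rewrite inE mem_cat xl !orbT.
  + by apply: bounded => // x xl; rewrite inE mem_cat xl orbT.
rewrite !big_cat /= !prod_copies -/A -/B.
have -> : \prod_(x <- nseq j s) p x = p s ^+ j.
  by elim: j {y_eq} => [|n IH]; rewrite ?big_nil // big_cons IH exprS.
have js_y : (s * j <= y)%N by rewrite -y_eq mulnC -addnA leq_addr.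
have runs : 1 <= p s ^+ j * rho ^+ y.
  rewrite -(subnKC js_y).
  rewrite exprD mulrA exprM -exprMn.
  by rewrite mulr_ege1 // exprn_ege1.
have rest : (A * B) ^+ s <= A ^+ i * B ^+ (s.-1 - i).
  rewrite exprMn; apply: ler_pM; try by rewrite exprn_ge0 ?ltW.
    by apply: ler_wiXn2l; rewrite ?(ltW A_gt0) ?(ltnW i_lt).
  apply: ler_wiXn2l; rewrite ?(ltW B_gt0) //.
  by apply: leq_trans (leq_subr _ _) (leq_pred _).
rewrite mulrAC; apply: le_trans rest _.
by rewrite ler_peMl // mulr_ge0 ?exprn_ge0 // ltW.
Qed.

End LikelyPaths.

(** * Walks that avoid a set *)

(* Positions and indices are compared by linear arithmetic alone, without the
   divisibility and probability facts. *)
Ltac nat_lia :=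
  repeat match goal with
    | H : context [dvdn] |- _ => clear H
    | H : context [@Order.le] |- _ => clear H
    | H : context [@Order.lt] |- _ => clear H
  end; lia.

Section Walk.
Context (R : realFieldType) (p : nat -> R) (L : nat).

(** The probability that [j] independent steps with law [p] are all at most [L]
    and lead from [x] through positions outside [B], [x] included. *)
Fixpoint avoid_mass (B : pred nat) (j x : nat) : R :=
  if B x then 0 else
  if j is j'.+1 then \sum_(s < L.+1) p s * avoid_mass B j' (x + s) else 1.

(** The probability that [K] independent steps with law [p] are all at most [L]
    and form a sequence with the property [Q]. *)
Fixpoint path_mass (K : nat) (Q : pred (seq nat)) : R :=
  if K is K'.+1 then
    \sum_(s < L.+1) p s * path_mass K' (fun l => Q (val s :: l))
  else (Q [::])%:R.

Hypothesis p_ge0 : forall s, 0 <= p s.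
Hypothesis p0 : p 0%N = 0.
Hypothesis mass_le1 : \sum_(s < L.+1) p s <= 1.

Lemma prod_le1_seq (l : seq nat) :
  all (fun x => x <= L)%N l -> \prod_(s <- l) p s <= 1.
Proof.
elim: l => [|s l IH] /=; first by rewrite big_nil.
case/andP=> sL /IH l_le1; rewrite big_cons mulr_ile1 ?prodr_ge0 //.
apply: le_trans mass_le1; rewrite (bigD1 (Ordinal (sL : (s < L.+1)%N))) //=.
by rewrite lerDl sumr_ge0.
Qed.

Lemma average_le (F : nat -> R) (M : R) : 0 <= M ->
  (forall s, (0 < s <= L)%N -> 0 < p s -> F s <= M) ->
  \sum_(s < L.+1) p s * F s <= M.
Proof.
move=> M_ge0 FM; apply: (@le_trans _ _ (\sum_(s < L.+1) p s * M)).
  apply: ler_sum => s _; have := p_ge0 s; rewrite le_eqVlt => /predU1P[<-|ps].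
    by rewrite !mul0r.
  apply: ler_wpM2l; first exact: ltW.
  apply: (FM s _ ps); rewrite lt0n -[(s <= L)%N]ltnS ltn_ord andbT.
  by apply: contraTneq ps => ->; rewrite p0 ltxx.
by rewrite -mulr_suml ler_piMl.
Qed.

Section Targets.
Variables (B : pred nat) (g : nat).
Hypothesis g_dvd : forall s, 0 < p s -> (g %| s)%N.

Lemma dvdn_step x s : (g %| x)%N -> 0 < p s -> (g %| x + s)%N.
Proof. by move=> gx ps; rewrite dvdn_add // g_dvd. Qed.

(** The walk follows the path [l] into [B] with probability [\prod p s].
    Otherwise it leaves the path at some step, at a position beyond [x] but at
    most [L] after the end of the path, from which it avoids [B] with
    probability at most [M]. *)
Lemma avoid_mass_path (l : seq nat) (x j j0 : nat) (M : R) : 0 <= M ->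
  (forall x' j', (x < x' <= x + sumn l + L)%N -> (g %| x')%N -> (j0 <= j')%N ->
     avoid_mass B j' x' <= M) ->
  (g %| x)%N -> B (x + sumn l)%N ->
  all (fun s => (0 < p s) && (s <= L)%N) l -> (j0 + size l <= j)%N ->
  avoid_mass B j x <= (1 - \prod_(s <- l) p s) * M.
Proof.
move=> M_ge0; elim: l x j => [|s l IH] x j /= later gx.
  rewrite addn0 => Bx _ _.
  by case: j => [|j] /=; rewrite Bx big_nil subrr mul0r.
move=> Bend /andP[/andP[ps sL] lP] j_ge.
have l_le1 : \prod_(i <- l) p i <= 1.
  by apply: prod_le1_seq; apply: sub_all lP => i /andP[].
have pos : 0 <= (1 - \prod_(i <- s :: l) p i) * M.
  rewrite mulr_ge0 // subr_ge0; apply: prod_le1_seq => /=; rewrite sL /=.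
  by apply: sub_all lP => i /andP[].
case: j j_ge => [|j] /= j_ge; first by rewrite addnS in j_ge.
case: ifP => // _.
have s_gt0 : (0 < s)%N.
  by rewrite lt0n; apply: contraTneq ps => ->; rewrite p0 ltxx.
have stay : avoid_mass B j (x + s) <= (1 - \prod_(i <- l) p i) * M.
  apply: IH; rewrite -?addnA ?dvdn_step //; last by nat_lia.
  by move=> x' j' x'P; apply: later; nat_lia.
have other i : (0 < i <= L)%N -> 0 < p i ->
    avoid_mass B j (x + i) <= M.
  move=> iL pi.
  by apply: later; [nat_lia | exact: dvdn_step | nat_lia].
have -> : \sum_(i < L.+1) p i * avoid_mass B j (x + i) =
    p s * avoid_mass B j (x + s) +
    \sum_(i < L.+1) p i * (if i == s :> nat then 0 else avoid_mass B j (x + i)).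
  rewrite (bigD1 (Ordinal (sL : (s < L.+1)%N))) //=.
  rewrite [X in _ = _ + X](bigD1 (Ordinal (sL : (s < L.+1)%N))) //=.
  rewrite eqxx mulr0 add0r; congr (_ + _); apply: eq_bigr => i.
  by rewrite -val_eqE /= => /negbTE ->.
have rest : \sum_(i < L.+1)
    p i * (if i == s :> nat then 0 else avoid_mass B j (x + i)) <=
    (1 - p s) * M.
  apply: (@le_trans _ _
    (\sum_(i < L.+1) p i * (if i == s :> nat then 0 else M))).
    rewrite -subr_ge0 -sumrB; apply: sumr_ge0 => i _.
    case: eqP => [_|ne]; first by rewrite subrr.
    have := p_ge0 i; rewrite le_eqVlt => /predU1P[<-|pi].
      by rewrite !mul0r subrr.
    rewrite subr_ge0 ler_wpM2l // other // lt0n -[(i <= L)%N]ltnS ltn_ord andbT.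
    by apply: contraTneq pi => ->; rewrite p0 ltxx.
  rewrite (bigD1 (Ordinal (sL : (s < L.+1)%N))) //= eqxx mulr0 add0r.
  rewrite (eq_bigr (fun i : 'I_L.+1 => p i * M)); last first.
    by move=> i; rewrite -val_eqE /= => /negbTE ->.
  rewrite -mulr_suml ler_wpM2r // lerBrDl.
  by move: mass_le1; rewrite (bigD1 (Ordinal (sL : (s < L.+1)%N))).
apply: le_trans (lerD (ler_wpM2l (p_ge0 s) stay) rest) _.
by rewrite big_cons mulrBl mul1r; lra.
Qed.

(** A walk with steps at most [L] cannot jump over the window
    [[x0, x0 + L]]. *)
Lemma avoid_mass_transport (x0 j0 : nat) (M : R) : 0 <= M ->
  (forall x j, (x0 <= x <= x0 + L)%N -> (g %| x)%N -> (j0 <= j)%N ->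
     avoid_mass B j x <= M) ->
  forall x j, (g %| x)%N -> (x <= x0 + L)%N -> (j0 + (x0 - x) <= j)%N ->
  avoid_mass B j x <= M.
Proof.
move=> M_ge0 start x j; elim: j x => [|j IH] x gx x_le j_ge.
  by apply: start => //; nat_lia.
have [x0x|xx0] := leqP x0 x; first by apply: start => //; nat_lia.
rewrite /=; case: ifP => // _.
apply: (@average_le (fun s => avoid_mass B j (x + s))) => // s sL ps.
by apply: IH; rewrite ?dvdn_step //; nat_lia.
Qed.

Variables (eps : R) (y0 lo hi : nat).
Hypothesis eps01 : 0 <= eps <= 1.
Hypothesis likely : forall y, (y0 <= y <= y0 + L)%N -> (g %| y)%N ->
  exists l, [/\ sumn l = y, all (fun s => (0 < p s) && (s <= L)%N) l &
                eps <= \prod_(s <- l) p s].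
Hypothesis dense : forall z, (lo <= z <= hi)%N ->
  exists b, [/\ B b, (z <= b <= z + L)%N & (g %| b)%N].

Lemma avoid_mass_le1 j x : avoid_mass B j x <= 1.
Proof.
elim: j x => [|j IH] x /=; case: ifP => // _.
by apply: (@average_le (fun s => avoid_mass B j (x + s))).
Qed.

(** One stage has length [y0 + 2 * L]: a target is found within [y0 + L] of the
    current position, and a failed attempt ends at most [L] beyond it. *)
Lemma avoid_mass_stages (I x j : nat) :
  (g %| x)%N -> (lo <= x + y0)%N -> (x + I * (y0 + 2 * L) <= hi)%N ->
  (I * (y0 + 2 * L) <= j)%N -> avoid_mass B j x <= (1 - eps) ^+ I.
Proof.
elim: I x j => [|I IH] x j gx lo_x x_hi j_ge; first by rewrite avoid_mass_le1.
have [eps_ge0 eps_le1] := andP eps01.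
rewrite mulSn in x_hi j_ge.
have [b [Bb b_range gb]] : exists b,
    [/\ B b, (x + y0 <= b <= x + y0 + L)%N & (g %| b)%N].
  by apply: dense; nat_lia.
have [l [l_sum l_ok l_mass]] : exists l,
    [/\ sumn l = (b - x)%N, all (fun s => (0 < p s) && (s <= L)%N) l &
        eps <= \prod_(s <- l) p s].
  by apply: likely; [nat_lia | rewrite dvdn_sub].
have l_size : (size l <= b - x)%N.
  rewrite -l_sum; elim: l l_ok {l_sum l_mass} => //= s l IHl.
  case/andP=> /andP[ps _] /IHl; have : s != 0%N.
    by apply: contraTneq ps => ->; rewrite p0 ltxx.
  by move=> ? ?; nat_lia.
rewrite exprS.
apply: (@le_trans _ _ ((1 - \prod_(s <- l) p s) * (1 - eps) ^+ I)).
  apply: (@avoid_mass_path _ _ _ (I * (y0 + 2 * L))) => //.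
  - by rewrite exprn_ge0 // subr_ge0.
  - by move=> x' j' x'_range gx' j'_ge; apply: IH => //; nat_lia.
  - by rewrite l_sum subnKC //; nat_lia.
  - by nat_lia.
by rewrite ler_wpM2r ?exprn_ge0 ?subr_ge0 // lerB.
Qed.

End Targets.

Lemma path_mass0 J (Q : pred (seq nat)) :
  (forall l, size l = J -> ~~ Q l) -> path_mass J Q = 0.
Proof.
elim: J Q => [|J IH] Q noQ /=; first by rewrite (negbTE (noQ [::] _)).
by apply: big1 => s _; rewrite IH ?mulr0 // => l lJ; apply: noQ; rewrite /= lJ.
Qed.

Lemma path_mass_avoid (B : pred nat) J x (Q : pred (seq nat)) :
  (forall l, size l = J -> Q l ->
     forall i, (i <= J)%N -> ~~ B (x + sumn (take i l))%N) ->
  path_mass J Q <= avoid_mass B J x.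
Proof.
elim: J x Q => [|J IH] x Q QB /=.
  case: ifP => Bx; last by case: (Q [::]).
  case Q0: (Q [::]) => //.
  by have := QB [::] erefl Q0 0%N isT; rewrite addn0 Bx.
case: ifP => Bx.
  rewrite big1 // => s _; rewrite path_mass0 ?mulr0 // => l lJ.
  apply/negP => Ql; have := QB (nat_of_ord s :: l) _ Ql 0%N isT.
  by rewrite /= lJ addn0 Bx => /(_ erefl).
apply: ler_sum => s _; apply: ler_wpM2l => //; apply: IH => l lJ Ql i iJ.
have := QB (nat_of_ord s :: l) _ Ql i.+1 iJ.
by rewrite /= lJ addnA; apply.
Qed.

(** Conditioning on the first [N] steps. *)
Lemma path_mass_split N J (Q : pred (seq nat)) (e : R) : 0 <= e ->
  (forall l, size l = N -> all (fun s => (0 < p s) && (s <= L)%N) l ->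
     path_mass J (fun l' => Q (l ++ l')) <= e) ->
  path_mass (N + J) Q <= e.
Proof.
move=> e_ge0; elim: N Q => [|N IH] Q Qe; first exact: (Qe [::]).
rewrite addSn /=.
apply: (@average_le (fun s => path_mass (N + J) (fun l => Q (s :: l)))) => //.
move=> s /andP[_ sL] ps; apply: IH => l lN lP.
by apply: (Qe (s :: l)); rewrite /= ?lN // ps sL.
Qed.

Definition pair_free (k tau : nat) (l : seq nat) : bool :=
  ~~ [exists i : 'I_(size l).+1, [exists j : 'I_(size l).+1,
      (k <= i < j)%N && (sumn (take i l) + sumn (take j l) == tau)%N]].

Lemma interval_hit (W : nat -> nat) k n v :
  (forall i, (k <= i < k + n)%N -> (W i.+1 <= W i + L)%N) ->
  (W k <= v <= W (k + n))%N ->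
  exists i, (k <= i <= k + n)%N && (W i <= v <= W i + L)%N.
Proof.
elim: n => [|n IH] step; first by rewrite addn0 => v_eq; exists k; nat_lia.
case/andP=> Wk; have [vn _|vn Wn] := leqP v (W (k + n)%N).
  have [||i iP] := IH; rewrite ?Wk //; last by exists i; nat_lia.
  by move=> i iP; apply: step; nat_lia.
exists (k + n)%N; have := step (k + n)%N; rewrite addnS in Wn *; nat_lia.
Qed.

(** The first [N] steps are given; [W] are their partial sums and [B] consists
    of the [tau - W i] with [k <= i < N].  The remaining walk has [tau] steps,
    which is enough to pass every element of [B].  The bound
    [2 * (N * L) + y0 <= tau] puts its start [W N] before [B], and [N - 1 - k],
    a lower bound for the extent of [B], leaves room for [I] stages after the
    arrival in the window of length [L]. *)
Lemma pair_free_mass (g y0 k I tau : nat) (eps : R) :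
  (forall s, 0 < p s -> (g %| s)%N) -> 0 <= eps <= 1 ->
  (forall y, (y0 <= y <= y0 + L)%N -> (g %| y)%N ->
     exists l, [/\ sumn l = y, all (fun s => (0 < p s) && (s <= L)%N) l &
                   eps <= \prod_(s <- l) p s]) ->
  (g %| tau)%N ->
  let N := (k + (L + I * (y0 + 2 * L)).+1)%N in
  (2 * (N * L) + y0 <= tau)%N ->
  path_mass (N + tau) (pair_free k tau) <= (1 - eps) ^+ I.
Proof.
move=> g_dvd eps01 likely gtau N N_tau.
have [eps_ge0 eps_le1] := andP eps01.
have bound_ge0 : 0 <= (1 - eps) ^+ I by rewrite exprn_ge0 // subr_ge0.
apply: path_mass_split => // l lN l_ok.
pose W i := sumn (take i l).
have step i : (i < N)%N -> exists2 s, (0 < s <= L)%N && (g %| s)%N &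
    W i.+1 = (W i + s)%N.
  move=> iN; exists (nth 0%N l i).
    have /andP[ps ->] := all_nthP 0%N l_ok i ltac:(by rewrite lN).
    rewrite g_dvd // !andbT lt0n; apply: contraTneq ps => ->.
    by rewrite p0 ltxx.
  by rewrite /W (take_nth 0%N) ?lN // sumn_rcons.
have W_dvd i : (i <= N)%N -> (g %| W i)%N.
  elim: i => [|i IH] iN; first by rewrite /W take0 dvdn0.
  by have [s /andP[_ gs] ->] := step i iN; rewrite dvdn_addr ?IH // ltnW.
have W_max i : (i <= N)%N -> (W i <= i * L)%N.
  elim: i => [|i IH] iN; first by rewrite /W take0.
  have [s /andP[? _] ->] := step i iN.
  by have := IH (ltnW iN); rewrite mulSn; nat_lia.
have W_min i n : (i + n <= N)%N -> (W i + n <= W (i + n))%N.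
  elim: n => [|n IH] iN; first by rewrite !addn0.
  rewrite !addnS in iN *; have [s /andP[? _] ->] := step _ iN.
  by have := IH (ltnW iN); nat_lia.
have WN_le : (W N <= N * L)%N by exact: W_max.
pose n := (L + I * (y0 + 2 * L))%N.
have N_eq : N = (k + n).+1 by rewrite /N addnS.
have I_le : (I * (y0 + 2 * L) <= n)%N by rewrite leq_addl.
have n_eq : n = (L + I * (y0 + 2 * L))%N by [].
clearbody n N.
pose B y := has (fun i => W i + y == tau)%N (iota k n.+1).
have Wkn_le : (W (k + n) <= W N)%N.
  by have := W_min (k + n)%N 1%N; rewrite addn1 -N_eq; nat_lia.
have Wk_le : (W k + n <= W (k + n))%N by apply: W_min; rewrite N_eq.
have dense z : (tau - W (k + n) <= z <= tau - W k)%N ->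
    exists b, [/\ B b, (z <= b <= z + L)%N & (g %| b)%N].
  move=> z_range.
  have [||i /andP[iP Wi]] := @interval_hit W k n (tau - z); last 1 first.
  - exists (tau - W i)%N; split.
    + apply/hasP; exists i; first by rewrite mem_iota addnS ltnS.
      by rewrite subnKC //; nat_lia.
    + by nat_lia.
    + by rewrite dvdn_sub // W_dvd // N_eq ltnW // ltnS; nat_lia.
  - move=> i iP; have [|s /andP[? _] ->] := step i; rewrite ?N_eq; nat_lia.
  - by nat_lia.
apply: (@le_trans _ _ (avoid_mass B tau (W N))).
  apply: path_mass_avoid => l' l'_size free i i_le.
  apply: contra free => /hasP[h]; rewrite mem_iota addnS ltnS => hP /eqP sum_eq.
  have hs : (h < (size (l ++ l')).+1)%N by rewrite size_cat lN; nat_lia.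
  have Nis : (N + i < (size (l ++ l')).+1)%N.
    by rewrite size_cat lN l'_size; nat_lia.
  apply/existsP; exists (Ordinal hs); apply/existsP; exists (Ordinal Nis) => /=.
  have hN : (h < N)%N by rewrite N_eq; nat_lia.
  apply/andP; split; first by nat_lia.
  rewrite take_cat lN hN take_cat lN ltnNge leq_addr /= addKn sumn_cat.
  by apply/eqP; rewrite -sum_eq /W -lN take_size.
apply: (@avoid_mass_transport B g g_dvd (tau - W (k + n)%N - y0)%N
  (I * (y0 + 2 * L))%N) => //; [|exact: W_dvd|nat_lia|nat_lia].
move=> x j x_range gx j_ge.
by apply: (avoid_mass_stages g_dvd eps01 likely dense) => //; nat_lia.
Qed.

End Walk.

(** * Polynomial against exponential growth *)

Section Growth.
Context (R : realType).

Lemma cubic_le_exp (C q : R) : 1 < q ->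
  exists n0 : nat, forall n, (n0 <= n)%N -> C * n.+1%:R ^+ 3 <= q ^+ n.
Proof.
move=> q_gt1; have del_gt0 : 0 < ln q by exact: ln_gt0.
(* n ^ 4 * ln q ^ 4 / 4! <= q ^ n and n + 1 <= 2 * n, and 192 = 4! * 2 ^ 3 *)
pose D := 192 * `|C| / ln q ^+ 4.
exists (Num.truncn D).+1 => n n_ge.
have n_D : D <= n%:R.
  by apply: le_trans (ltW (truncnS_gt D)) _; rewrite ler_nat.
have n_ge1 : 1 <= n%:R :> R by rewrite ler1n; lia.
have -> : q ^+ n = expR (n%:R * ln q).
  by rewrite expRM_natl lnK // posrE; apply: lt_trans q_gt1.
have := expR_ge1Dxn 3 (mulr_ge0 (ler0n R n) (ltW del_gt0)).
apply: le_trans; rewrite (_ : 4`! = 24)%N // exprMn.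
have : 192 * `|C| <= n%:R * ln q ^+ 4.
  by move: n_D; rewrite ler_pdivrMr // exprn_gt0.
have : n.+1%:R <= 2 * n%:R :> R by rewrite -natr1; lra.
move: (ler_norm C) (normr_ge0 C) n_ge1.
move: `|C| (ln q ^+ 4) (n%:R : R) => c l x.
have : 0 <= n.+1%:R :> R by [].
move: (n.+1%:R : R) => y y_ge0 Cc c_ge0 x_ge1 yx cl.
have y3 : y ^+ 3 <= 8 * x ^+ 3.
  apply: (@le_trans _ _ ((2 * x) ^+ 3)).
    by rewrite lerXn2r ?nnegrE //; lra.
  by rewrite exprMn; lra.
have x3 : 0 <= x ^+ 3 by rewrite exprn_ge0 //; lra.
apply: (@le_trans _ _ (c * (8 * x ^+ 3))).
  apply: (@le_trans _ _ (c * y ^+ 3)); first by rewrite ler_wpM2r // exprn_ge0.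
  by rewrite ler_wpM2l.
have := ler_wpM2l x3 cl.
rewrite (exprS x 3); lra.
Qed.

Lemma stage_budget (k l I y0 : nat) :
  (2 * ((k + (l + I * (y0 + 2 * l)).+1) * l) + y0 <=
  (2 * (k + 2) + y0) * l.+1 ^ 2 + 2 * (y0 + 2) * (I * l.+1 ^ 2))%N.
Proof.
have l_sq : (l <= l.+1 ^ 2)%N.
  by rewrite expnS expn1; apply: leq_trans (leq_pmulr _ _).
have ll_sq : (l * l <= l.+1 ^ 2)%N by rewrite expnS expn1 leq_mul.
have sl_sq : (l.+1 * l <= l.+1 ^ 2)%N by rewrite expnS expn1 leq_mul.
have sq_gt0 : (0 < l.+1 ^ 2)%N by rewrite expn_gt0.
set u := (l.+1 ^ 2)%N in l_sq ll_sq sl_sq sq_gt0 *.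
apply: (@leq_trans
  (2 * (k * u + u + I * (y0 * u + 2 * u)) + y0 * u)%N); last first.
  by clear; rewrite -subn_eq0; apply/eqP; lia.
apply: leq_add; last exact: leq_pmulr.
have -> : ((k + (l + I * (y0 + 2 * l)).+1) * l =
    k * l + l.+1 * l + I * (y0 * l + 2 * (l * l)))%N by ring.
rewrite leq_mul2l /=; apply: leq_add; first exact: leq_add (leq_mul _ _) _.
by rewrite leq_mul // leq_add // leq_mul.
Qed.

(** About [l * rho ^ l] stages are needed; each takes [O(l)] steps of length at
    most [l], so their total length is [O(l ^ 3 * rho ^ l)], which is less than
    [a ^ l] in the end. *)
Lemma stage_count (rho a kap : R) (y0 k : nat) :
  1 <= rho -> rho < a -> 0 < kap <= 1 ->
  exists l0 : nat, forall l, (l0 <= l)%N -> exists I : nat,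
    (1 - kap / rho ^+ (y0 + l)) ^+ I <= (a ^+ (2 * l))^-1 /\
    (2 * ((k + (l + I * (y0 + 2 * l)).+1) * l) + y0)%:R <= a ^+ l.
Proof.
move=> rho_ge1 rho_a /andP[kap_gt0 kap_le1].
have rho_gt0 : 0 < rho by apply: lt_le_trans rho_ge1.
have a_gt1 : 1 < a by apply: le_lt_trans rho_a.
have a_gt0 : 0 < a by apply: lt_trans a_gt1.
have lna_gt0 : 0 < ln a by exact: ln_gt0.
pose A := 2 * ln a * rho ^+ y0 / kap.
have A_ge0 : 0 <= A.
  by rewrite divr_ge0 ?mulr_ge0 ?exprn_ge0 ?ltW.
pose C := (2 * (k + 2) + y0)%:R + (2 * (y0 + 2))%:R * (A + 1).
have q_gt1 : 1 < a / rho by rewrite ltr_pdivlMr // mul1r.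
have [l0 l0P] := cubic_le_exp C q_gt1.
exists l0 => l /l0P growth.
pose eps := kap / rho ^+ (y0 + l).
have eps_gt0 : 0 < eps by rewrite divr_gt0 ?exprn_gt0.
have eps_le1 : eps <= 1.
  rewrite ler_pdivrMr ?exprn_gt0 // mul1r; apply: le_trans kap_le1 _.
  exact: exprn_ege1.
pose x := (2 * l)%:R * ln a / eps.
have x_ge0 : 0 <= x.
  by apply: divr_ge0; [apply: mulr_ge0 => //; exact: ltW | exact: ltW].
exists (Num.truncn x).+1; split.
  rewrite -/eps; apply: (@le_trans _ _ (expR (- eps) ^+ (Num.truncn x).+1)).
    by rewrite lerXn2r ?nnegrE ?expR_ge0 ?subr_ge0 // expR_ge1Dx.
  rewrite -expRM_natl.
  rewrite -[X in X^-1](@lnK _ (a ^+ _)) ?posrE ?exprn_gt0 // -expRN ler_expR.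
  rewrite lnXn // mulrN lerN2 -ler_pdivrMr // -[ln a *+ _]mulr_natl.
  exact: ltW (truncnS_gt x).
have I_le : (Num.truncn x).+1%:R <= (A + 1) * (l.+1%:R * rho ^+ l).
  have rl : 1 <= rho ^+ l by exact: exprn_ege1.
  have lrl : 1 <= l.+1%:R * rho ^+ l by rewrite mulr_ege1 // ler1n.
  rewrite -natr1 mulrDl mul1r; apply: lerD => //.
  apply: (@le_trans _ _ x); first by rewrite truncn_le.
  have -> : x = A * (l%:R * rho ^+ l).
    rewrite /x /eps /A natrM exprD; field.
    by rewrite !expf_neq0 ?gt_eqF.
  rewrite ler_wpM2l // ler_wpM2r ?exprn_ge0 ?(ltW rho_gt0) //.
  by rewrite ler_nat.
have := growth; rewrite expr_div_n ler_pdivlMr ?exprn_gt0 //; apply: le_trans.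
move: (Num.truncn x).+1 I_le => I I_le.
set u : R := l.+1%:R in I_le *; set r := rho ^+ l in I_le *.
have u_ge1 : 1 <= u by rewrite ler1n.
have r_ge1 : 1 <= r by exact: exprn_ege1.
have lu : l%:R <= u by rewrite ler_nat.
have step1 : (2 * ((k + (l + I * (y0 + 2 * l)).+1) * l) + y0)%N%:R <=
    (2 * (k + 2) + y0)%:R * u ^+ 2 + (2 * (y0 + 2))%:R * (I%:R * u ^+ 2).
  by rewrite -natrX -!natrM -natrD ler_nat stage_budget.
apply: le_trans step1 _.
have ur : u ^+ 2 <= u ^+ 3 * r.
  rewrite (exprSr u 2) -mulrA ler_peMr ?exprn_ge0 ?(le_trans ler01) //.
  exact: mulr_ege1.
have Iur : I%:R * u ^+ 2 <= (A + 1) * (u ^+ 3 * r).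
  apply: le_trans (ler_wpM2r _ I_le) _.
    by rewrite exprn_ge0 // (le_trans ler01).
  by rewrite le_eqVlt; apply/orP; left; apply/eqP; rewrite (exprS u 2); ring.
rewrite /C mulrDl mulrDl; apply: lerD.
  by rewrite -mulrA ler_wpM2l.
by rewrite -mulrA -mulrA -(mulrA (A + 1)) ler_wpM2l.
Qed.

Lemma block_index (a : R) (l0 tau : nat) : 1 < a -> (0 < tau)%N ->
  a ^+ l0 <= tau%:R ->
  exists2 l : nat, (l0 <= l)%N & a ^+ l <= tau%:R < a ^+ l.+1.
Proof.
move=> a_gt1 tau_gt0 l0_tau.
have ex_l : exists l, tau%:R < a ^+ l.+1.
  have [l lP] := cubic_le_exp tau.+1%:R a_gt1.
  exists l; apply: lt_le_trans (lP l.+1 _); last by rewrite leqnSn.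
  by rewrite -natrX -natrM ltr_nat -addn1; apply: leq_trans (leq_pmulr _ _);
    rewrite ?addn1 ?expn_gt0.
case: (ex_minnP ex_l) => l l_gt l_min; exists l.
  rewrite leqNgt; apply/negP => l_l0.
  have := le_lt_trans l0_tau l_gt.
  by rewrite ltNge ler_eXn2l // l_l0.
rewrite l_gt andbT; case: l l_gt l_min => [|l] _ l_min.
  by rewrite expr0 ler1n.
by rewrite leNgt; apply/negP => /l_min; rewrite ltnn.
Qed.

End Growth.

(** * Events of small probability *)

Section OuterBound.
Context (d : measure_display) (T : measurableType d) (R : realType).
Context (P : probability T R).

(** A bound for the outer probability of [A]: it spares the proof that [A] is
    measurable. *)
Definition prob_le (A : set T) (e : R) : Prop :=
  exists Y, [/\ measurable Y, A `<=` Y & (P Y <= e%:E)%E].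

Lemma prob_leS (A B : set T) (e e' : R) :
  A `<=` B -> e <= e' -> prob_le B e -> prob_le A e'.
Proof.
move=> AB ee' [Y [mY BY PY]]; exists Y; split=> //.
  exact: subset_trans BY.
by apply: le_trans PY _; rewrite lee_fin.
Qed.

Lemma prob_le_bigcup n (F : nat -> set T) (e : nat -> R) :
  (forall i, (i < n)%N -> prob_le (F i) (e i)) ->
  prob_le (\bigcup_(i < n) F i) (\sum_(i < n) e i).
Proof.
move=> Fe.
have /choice[Y YP] : forall i, exists Y, (i < n)%N ->
    [/\ measurable Y, F i `<=` Y & (P Y <= (e i)%:E)%E].
  move=> i; case: (ltnP i n) => [/Fe[Y YP]|ni]; first by exists Y.
  by exists set0.
exists (\big[setU/set0]_(i < n) Y i); split.
- by apply: bigsetU_measurable => i _; have [] := YP i (ltn_ord i).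
- rewrite -bigcup_mkord => w [i /= i_n Fw]; exists i => //.
  by have [_ + _] := YP i i_n; apply.
apply: le_trans (Boole_inequality _ _) _.
  by move=> i /YP[].
rewrite -sumEFin; apply: lee_sum => i _.
by have [] := YP i (ltn_ord i).
Qed.

Lemma prob_leU (A B : set T) (e e' : R) :
  prob_le A e -> prob_le B e' -> prob_le (A `|` B) (e + e').
Proof.
move=> [Y [mY AY PY]] [Z [mZ BZ PZ]]; exists (Y `|` Z); split.
- exact: measurableU.
- exact: setUSS.
- by rewrite EFinD; apply: le_trans (measureU2 P mY mZ) _; exact: leeD.
Qed.

(** Borel-Cantelli, for events bounded by a geometric sequence. *)
Lemma ae_eventually_not (F : nat -> set T) (C z : R) (n0 : nat) :
  0 <= C -> 0 <= z < 1 ->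
  (forall n, (n0 <= n)%N -> prob_le (F n) (C * z ^+ n)) ->
  {ae P, forall w, exists n1, forall n, (n1 <= n)%N -> ~ F n w}.
Proof.
move=> C_ge0 /andP[z_ge0 z_lt1] FP.
have /choice[Y YP] : forall n, exists Y,
    [/\ measurable Y, (n0 <= n)%N -> F n `<=` Y & (P Y <= (C * z ^+ n)%:E)%E].
  move=> n; case: (leqP n0 n) => [/FP[Y [mY FY PY]]|n_lt]; first by exists Y.
  by exists set0; rewrite measure0 lee_fin mulr_ge0 // exprn_ge0.
have mY n : measurable (Y n) by have [] := YP n.
have sumY : (\sum_(n <oo) P (Y n) < +oo)%E.
  apply: (@le_lt_trans _ _ (C / (1 - z))%:E); last exact: ltry.
  apply: lime_le; first by apply: is_cvg_nneseries => n _ _; exact: measure_ge0.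
  apply: nearW => n /=.
  apply: (@le_trans _ _ (\sum_(0 <= k < n) (C * z ^+ k)%:E)%E).
    by apply: lee_sum => k _; have [] := YP k.
  rewrite sumEFin lee_fin.
  have := @geometric_seriesE R C z.
  rewrite /series /= => /(_ _)/funeqP/(_ n) ->.
    rewrite ler_wpM2r ?invr_ge0 ?subr_ge0 ?(ltW z_lt1) //.
    by rewrite ler_piMr // lerBlDr lerDl exprn_ge0.
  by rewrite lt_eqF.
have null := lim_sup_set_cvg0 mY sumY.
exists (lim_sup_set Y); split=> //.
  by apply: bigcap_measurable => // n _; apply: bigcup_measurable => k _.
move=> w /= never n _; apply: contrapT => notY; apply: never.
exists (maxn n n0) => k; rewrite geq_max => /andP[nk n0k] Fk.
by apply: notY; exists k => //; have [_ FY _] := YP k; exact: (FY n0k w Fk).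
Qed.

End OuterBound.

(** * The law of one step *)

Section Rates.
Context (d : measure_display) (T : measurableType d) (R : realType).
Context (P : probability T R) (X : {RV P >-> nat}).
Hypothesis Xpos : forall w, (0 < X w)%N.

Lemma level_measurable (A : set nat) : measurable (X @^-1` A).
Proof. by rewrite -[X in measurable X]setTI; exact: measurable_funP. Qed.

Lemma level_fin (A : set nat) : P (X @^-1` A) \is a fin_num.
Proof. by apply: fin_num_measure; exact: level_measurable. Qed.

Definition mass (s : nat) : R := fine (P (X @^-1` [set s])).

Lemma level_le1 (A : set nat) : fine (P (X @^-1` A)) <= 1.
Proof.
rewrite -lee_fin fineK ?level_fin //.
by apply: probability_le1; exact: level_measurable.
Qed.

Lemma atom_exists : exists s, (0 < P (X @^-1` [set s]))%E.
Proof.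
apply: contrapT => /forallNP none.
have : P.-negligible (\bigcup_s (X @^-1` [set s])).
  apply: negligible_bigcup => s; apply/negligibleP.
    exact: level_measurable.
  by apply/eqP; rewrite -measure_le0 leNgt; apply/negP; exact: none.
rewrite (_ : \bigcup_s _ = setT); last first.
  by apply/seteqP; split=> // w _; exists (X w).
move=> /(measure_negligible measurableT) PT0.
have := probability_setT P; rewrite [X in X = _]PT0 => /eqP.
by rewrite eq_sym onee_eq0.
Qed.

Lemma mass_ge0 s : 0 <= mass s.
Proof. by rewrite fine_ge0. Qed.

Lemma mass_le1 s : mass s <= 1.
Proof. exact: level_le1. Qed.

Lemma massE s : P (X @^-1` [set s]) = (mass s)%:E.
Proof. by rewrite fineK // level_fin. Qed.

Lemma mass0 : mass 0 = 0.
Proof.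
rewrite /mass (_ : _ @^-1` _ = set0) ?measure0 //.
by apply/seteqP; split=> // w /= Xw; have := Xpos w; rewrite Xw.
Qed.

Lemma theta_ge0 : 0 <= theta X.
Proof.
apply: lb_le_inf.
  by have [s sP] := atom_exists; exists (- ln (mass s) / s%:R); exists s.
move=> _ [s /= _ <-]; apply: divr_ge0 => //; rewrite oppr_ge0; apply: ln_le0.
exact: (level_le1 [set s]).
Qed.

(** Chernoff's bound, transferred to a variable with values in [nat]. *)
Lemma tail_le (t : R) (l : nat) : 0 < t ->
  (P (X @^-1` [set x | (l < x)%N]) <= mgf X t * (expR (- (t * l%:R)))%:E)%E.
Proof.
move=> t_gt0.
have mXR : measurable_fun setT (fun w => (X w)%:R : R).
  apply: (@measurableT_comp _ _ _ _ _ _ (fun n : nat => n%:R : R)) => //.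
pose XR : {RV P >-> R} := mfun_Sub (mem_set mXR).
apply: le_trans (chernoff XR l%:R t_gt0).
apply: le_measure; rewrite ?inE.
- exact: level_measurable.
- rewrite -[X in measurable X]setTI.
  exact: (measurable_fun_le measurableT (measurable_cst _) mXR).
- by move=> w /= /ltnW; rewrite ler_nat.
Qed.

(** The factor 2 in the hypothesis becomes [rho < a] together with a tail
    [a ^- (2 * l)]: the square leaves a factor [a ^- l] to spare after a union
    bound over the [O(a ^ l)] steps of a block. *)
Lemma exponential_rates :
  ((2 * theta X)%:E < mgf_radius X)%E ->
  exists (rho a C : R) (s : nat),
  [/\ 1 <= rho < a, 0 <= C, 1 <= mass s * rho ^+ s &
      forall l : nat,
        (P (X @^-1` [set x | (l < x)%N]) <= (C / a ^+ (2 * l))%:E)%E].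
Proof.
move=> /ereal_sup_gt[_ [r [_ finite] <-]]; rewrite lte_fin => theta_r.
have theta0 := theta_ge0.
pose t := (2 * theta X + r) / 2.
have t_gt : 2 * theta X < t by rewrite /t; lra.
have t_gt0 : 0 < t by lra.
have mgf_fin : (mgf X t < +oo)%E by apply: finite; rewrite gtr0_norm // /t; lra.
have [] := @inf_lt _ [set - ln (fine (distribution P X [set s])) / s%:R
      | s in [set s : nat | (0 < distribution P X [set s])%E]] (t / 2).
- by have [s sP] := atom_exists; exists (- ln (mass s) / s%:R); exists s.
- by rewrite -/(theta X); lra.
move=> _ [s /= ps_gt0 <-] rate_lt.
have ps_fin := level_fin [set s].
have q_gt0 : 0 < fine (P (X @^-1` [set s])).
  by rewrite -lte_fin fineK.
have q_le1 := level_le1 [set s].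
have s_gt0 : (0 < s)%N.
  case: s {rate_lt ps_fin q_gt0 q_le1} ps_gt0 => // ps_gt0; exfalso.
  move: ps_gt0; rewrite /distribution /pushforward.
  rewrite (_ : _ @^-1` _ = set0) ?measure0 ?ltxx //.
  by apply/seteqP; split=> // w /= Xw; have := Xpos w; rewrite Xw.
exists (expR (- ln (fine (P (X @^-1` [set s]))) / s%:R)), (expR (t / 2)),
  (fine (mgf X t)), s.
have mgf_ge0 : (0 <= mgf X t)%E.
  by apply: expectation_ge0 => w /=; exact: expR_ge0.
split.
- rewrite ltr_expR rate_lt andbT -expR0 ler_expR divr_ge0 // oppr_ge0.
  exact: ln_le0.
- exact: fine_ge0.
- rewrite /mass -expRM_natl [s%:R * _]mulrC divfK ?pnatr_eq0 -?lt0n //.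
  rewrite expRN lnK ?posrE //.
  by rewrite mulfV // gt_eqF.
move=> l; apply: le_trans (tail_le l t_gt0) _.
rewrite EFinM fineK ?ge0_fin_numE //.
rewrite -expRM_natl expRN (_ : (2 * l)%:R * (t / 2) = t * l%:R) //.
by rewrite natrM; field.
Qed.

End Rates.

(** * From independent steps to weights of paths *)

Section Cylinders.
Context (d : measure_display) (T : measurableType d) (R : realType).
Context (P : probability T R) (X : nat -> {RV P >-> nat}).
Hypothesis Xindep : mutually_independent X.
Hypothesis Xid : identically_distributed X.

Let p := mass (X 0%N).

Lemma mass_all i s : P (X i @^-1` [set s]) = (p s)%:E.
Proof.
by rewrite -massE; have := Xid i 0 (A := [set s]); apply.
Qed.

Lemma cylinder_prob (l : seq nat) :
  P (\bigcap_(i in [set i | (i < size l)%N]) (X i @^-1` [set nth 0%N l i])) =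
  (\prod_(s <- l) p s)%:E.
Proof.
pose J := [fset i in iota 0 (size l)]%fset.
have := @Xindep J (fun i => [set nth 0%N l i]) (fun i => I).
rewrite (_ : [set` J] = [set i | (i < size l)%N]); last first.
  by apply/seteqP; split=> i /=; rewrite !inE mem_iota add0n.
move=> ->.
have perm_J : perm_eq J (iota 0 (size l)).
  by apply: uniq_perm; rewrite ?fset_uniq ?iota_uniq // => i; rewrite !inE.
rewrite (perm_big _ perm_J) /= [in RHS](big_nth 0%N) /index_iota subn0.
rewrite (eq_bigr (fun i => (p (nth 0%N l i))%:E)) => [|i _].
  by rewrite prodEFin.
exact: mass_all.
Qed.

Lemma mass_sum_le1 n : \sum_(s < n) p s <= 1.
Proof.
rewrite -lee_fin -sumEFin.
rewrite (eq_bigr (fun s : 'I_n =>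
  P (X 0%N @^-1` [set val s]))) => [|i _]; last first.
  by rewrite mass_all.
rewrite -(@measure_bigsetU _ _ _ P (fun s => X 0%N @^-1` [set s])) //.
- by apply: probability_le1; apply: bigsetU_measurable => i _;
    exact: level_measurable.
- by move=> i; exact: level_measurable.
- apply/trivIsetP => i j _ _ ij; apply/seteqP; split=> // w [/= -> /eqP].
  by rewrite (negbTE ij).
Qed.

(** The values [l] of the first steps are prescribed so that the induction on
    the number [K] of remaining steps can split on the next value. *)
Lemma prob_le_path L K (Q : pred (seq nat)) (l : seq nat) :
  prob_le P [set w | [/\ forall i, (i < size l)%N -> X i w = nth 0%N l i,
                      forall i, (i < K)%N -> (X (size l + i) w <= L)%N &
                      Q (mkseq (fun i => X (size l + i)%N w) K)]]
    ((\prod_(s <- l) p s) * path_mass p L K Q).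
Proof.
elim: K l Q => [|K IH] l Q /=.
  case: (Q [::]); last first.
    by exists set0; rewrite measure0 mulr0; split=> // w [].
  exists (\bigcap_(i in [set i | (i < size l)%N])
            (X i @^-1` [set nth 0%N l i])).
  rewrite cylinder_prob mulr1; split=> //.
    by apply: bigcap_measurableType => i _; exact: level_measurable.
  by move=> w [/= wl _ _] i /= i_l; exact: wl.
rewrite mulr_sumr.
pose F s := [set w |
  [/\ forall i, (i < size (rcons l s))%N -> X i w = nth 0%N (rcons l s) i,
      forall i, (i < K)%N -> (X (size (rcons l s) + i) w <= L)%N &
      Q (s :: mkseq (fun i => X (size (rcons l s) + i)%N w) K)]].
apply: (@prob_leS _ _ _ _ _ (\bigcup_(s < L.+1) F s) (\sum_(s < L.+1)
  (\prod_(i <- rcons l s) p i) * path_mass p L K (fun l' => Q (val s :: l')))).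
- move=> w [/= wl w_le Qw]; exists (X (size l) w).
    by rewrite /= ltnS; have := w_le 0%N isT; rewrite addn0.
  split.
  + move=> i; rewrite size_rcons ltnS nth_rcons.
    by case: ltngtP => // [/wl //|-> //].
  + by move=> i iK; rewrite size_rcons addSnnS; apply: w_le.
  + move: Qw; congr (is_true (Q _)).
    rewrite -[K.+1]add1n /mkseq iotaD /= addn0; congr (_ :: _).
    rewrite -[iota _ K in LHS]/(iota (1 + 0) K) iotaDl -map_comp.
    apply: eq_map => i /=.
    by rewrite size_rcons addnA addn1.
- by apply: ler_sum => s _; rewrite -cats1 big_cat /= big_seq1 mulrA.
apply: (@prob_le_bigcup _ _ _ P L.+1 F (fun s =>
  (\prod_(i <- rcons l s) p i) * path_mass p L K (fun l' => Q (s :: l')))).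
by move=> s _; apply: IH.
Qed.

End Cylinders.

(** * Targets that are not a sum of two partial sums *)

Section Pairs.
Context (d : measure_display) (T : measurableType d) (R : realType).
Context (P : probability T R) (X : nat -> {RV P >-> nat}).
Hypothesis Xpos : forall i w, (0 < X i w)%N.
Hypothesis Xindep : mutually_independent X.
Hypothesis Xid : identically_distributed X.

Definition has_pair (k tau : nat) (w : T) : Prop :=
  exists i j, (k <= i < j)%N /\ (partial_sum X i w + partial_sum X j w = tau)%N.

Definition missed (a : R) (g k l : nat) : set T :=
  [set w | exists tau : nat, [/\ a ^+ l <= tau%:R < a ^+ l.+1, (g %| tau)%N &
             ~ has_pair k tau w]].

Lemma partial_sum_take i K w : (i <= K)%N ->
  sumn (take i (mkseq (fun n => X n w) K)) = partial_sum X i w.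
Proof.
move=> iK; rewrite /mkseq -map_take take_iota (minn_idPl iK) sumnE big_map.
by rewrite /partial_sum -(big_mkord xpredT (fun n => X n w)) /index_iota subn0.
Qed.

(** Either one of the first [O(a ^ l)] steps exceeds [l], or one of the
    [O(a ^ l)] targets of the block is missed by a walk with steps at most [l];
    each of these events has probability [O(a ^- (2 * l))]. *)
Lemma missed_prob (rho a C kap : R) (g y0 L0 k : nat) :
  1 <= rho < a -> 0 <= C -> 0 < kap <= 1 ->
  (forall l : nat,
     (P (X 0%N @^-1` [set x | (l < x)%N]) <= (C / a ^+ (2 * l))%:E)%E) ->
  (forall x, 0 < mass (X 0%N) x -> (g %| x)%N) ->
  (forall y, (y0 <= y)%N -> (g %| y)%N -> exists l : seq nat,
     [/\ sumn l = y, all (fun x => (0 < mass (X 0%N) x) && (x <= L0)%N) l &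
         kap <= (\prod_(x <- l) mass (X 0%N) x) * rho ^+ y]) ->
  exists n0 : nat, forall l, (n0 <= l)%N ->
    prob_le P (missed a g k l) ((4 * C + 2) * a * a^-1 ^+ l).
Proof.
move=> /andP[rho_ge1 rho_a] C_ge0 kap01 tail g_dvd likely.
have rho_gt0 : 0 < rho by apply: lt_le_trans rho_ge1.
have a_gt1 : 1 < a by apply: le_lt_trans rho_a.
have a_gt0 : 0 < a by apply: lt_trans a_gt1.
have [l0 l0P] := stage_count y0 k rho_ge1 rho_a kap01.
exists (maxn l0 (maxn L0 1)) => l; rewrite !geq_max.
case/and3P=> /l0P[I [I_stages I_small]] L0l l_gt0.
have [kap_gt0 kap_le1] := andP kap01.
pose N := (k + (l + I * (y0 + 2 * l)).+1)%N.
pose M := (Num.truncn (a ^+ l.+1)).+1.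
pose long i := X i @^-1` [set x | (l < x)%N].
pose free (tau : nat) := [set w | [/\ a ^+ l <= tau%:R, (g %| tau)%N,
  forall i, (i < N + tau)%N -> (X i w <= l)%N &
  pair_free k tau (mkseq (fun i => X i w) (N + tau))]].
have N_le (tau : nat) : a ^+ l <= tau%:R -> (2 * (N * l) + y0 <= tau)%N.
  by move=> a_tau; rewrite -(ler_nat R); apply: le_trans a_tau.
have l_mass_le1 := mass_sum_le1 Xid l.+1.
have path_bound (tau : nat) : a ^+ l <= tau%:R -> (g %| tau)%N ->
    path_mass (mass (X 0%N)) l (N + tau) (pair_free k tau) <= (a ^+ (2 * l))^-1.
  move=> a_tau g_tau; apply: le_trans I_stages.
  apply: (@pair_free_mass _ _ _ _ _ _ g) => //.
  - exact: mass_ge0.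
  - exact: mass0.
  - apply/andP; split; first by rewrite divr_ge0 ?exprn_ge0 ?ltW.
    rewrite ler_pdivrMr ?exprn_gt0 // mul1r; apply: le_trans kap_le1 _.
    exact: exprn_ege1.
  - move=> y /andP[y0y y_le] gy.
    have [s [s_sum s_ok s_mass]] := likely y y0y gy.
    exists s; split=> //.
      by apply: sub_all s_ok => x /andP[-> /leq_trans]; apply.
    rewrite ler_pdivrMr ?exprn_gt0 //; apply: le_trans s_mass _.
    apply: ler_wpM2l; first by apply: prodr_ge0 => x _; exact: mass_ge0.
    exact: ler_weXn2l.
  - exact: N_le.
have free_prob (tau : nat) : prob_le P (free tau) (a ^+ (2 * l))^-1.
  have [a_tau|no] := boolP (a ^+ l <= tau%:R); last first.
    exists set0; rewrite measure0 lee_fin invr_ge0 exprn_ge0 ?ltW //.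
    by split=> // w []; rewrite (negbTE no).
  have [g_tau|no] := boolP (g %| tau)%N; last first.
    exists set0; rewrite measure0 lee_fin invr_ge0 exprn_ge0 ?ltW //.
    by split=> // w []; rewrite (negbTE no).
  apply: prob_leS (path_bound tau a_tau g_tau) _; last first.
    have := prob_le_path Xindep Xid l (N + tau) (pair_free k tau) [::].
    by rewrite big_nil mul1r; apply.
  by move=> w [_ _ w_le w_free]; split.
have long_prob i : prob_le P (long i) (C / a ^+ (2 * l)).
  exists (long i); split=> //; first exact: level_measurable.
  have same : P (long i) = P (X 0%N @^-1` [set x | (l < x)%N]).
    by have := Xid i 0 (A := [set x | (l < x)%N]); apply.
  by rewrite same; exact: tail.
apply: (@prob_leS _ _ _ _ _
  ((\bigcup_(i < 2 * M) long i) `|` (\bigcup_(tau < M) free tau))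
  (\sum_(i < 2 * M) C / a ^+ (2 * l) + \sum_(tau < M) (a ^+ (2 * l))^-1)).
- move=> w [tau [/andP[a_tau tau_a] g_tau no_pair]].
  have tau_M : (tau < M)%N.
    rewrite -(ltr_nat R); apply: lt_trans tau_a _; exact: truncnS_gt.
  have N_tau : (N <= tau)%N.
    apply: leq_trans (N_le tau a_tau); apply: leq_trans (leq_addr _ _).
    by rewrite mulnCA leq_pmulr // muln_gt0.
  have [[i [i_M Xi]]|short] :=
    pselect (exists i, (i < 2 * M)%N /\ (l < X i w)%N); first by left; exists i.
  right; exists tau => //; split=> //.
    move=> i i_lt; rewrite leqNgt; apply/negP => Xi; apply: short; exists i.
    split=> //; apply: leq_trans i_lt _; rewrite mul2n -addnn.
    by apply: leq_add; [exact: leq_trans N_tau (ltnW tau_M) | exact: ltnW].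
  apply/negP => /existsP[i /existsP[j /andP[kij /eqP sum_eq]]].
  apply: no_pair; exists i, j; split=> //.
  have iK : (i <= N + tau)%N.
    by have := ltn_ord i; rewrite ltnS [X in (_ <= X)%N]size_mkseq.
  have jK : (j <= N + tau)%N.
    by have := ltn_ord j; rewrite ltnS [X in (_ <= X)%N]size_mkseq.
  by rewrite -(partial_sum_take w iK) -(partial_sum_take w jK).
- rewrite !sumr_const !card_ord.
  have M_le : M%:R <= 2 * a ^+ l.+1.
    have := @truncn_le R (a ^+ l.+1).
    rewrite exprn_ge0 ?(ltW a_gt0) // => trunc_le.
    by rewrite /M -natr1; have := exprn_ege1 l.+1 (ltW a_gt1); lra.
  have -> : (C / a ^+ (2 * l)) *+ (2 * M) + (a ^+ (2 * l))^-1 *+ M =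
      ((2 * C + 1) / a ^+ (2 * l)) * M%:R.
    rewrite -(mulr_natr _ (2 * M)) -[_^-1 *+ M]mulr_natr natrM.
    move: (a ^+ (2 * l))^-1 (M%:R : R) => b x.
    by ring.
  apply: (@le_trans _ _ (((2 * C + 1) / a ^+ (2 * l)) * (2 * a ^+ l.+1))).
    apply: ler_wpM2l M_le; apply: divr_ge0; first lra.
    by rewrite exprn_ge0 // ltW.
  rewrite mul2n -addnn exprD exprS exprVn le_eqVlt; apply/orP; left; apply/eqP.
  have : a ^+ l != 0 by rewrite gt_eqF // exprn_gt0.
  have a_neq0 : a != 0 by rewrite gt_eqF.
  move: (a ^+ l) => q q_neq0.
  by field; rewrite q_neq0.
apply: prob_leU; first by apply: (@prob_le_bigcup _ _ _ _ _ _ (fun=> _)).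
by apply: (@prob_le_bigcup _ _ _ _ _ _ (fun=> _)).
Qed.

End Pairs.

(** * From pairs to sums of m terms *)

(** The first [m - 2] terms have a fixed sum [V], a multiple of [g]; the pair
    that represents [n * g - V] uses later terms only. *)
Lemma complete_of_pairs (W : nat -> nat) (g m n0 : nat) :
  (forall i, (W i < W i.+1)%N) -> (0 < g)%N -> (forall i, (g %| W i)%N) ->
  (2 <= m)%N ->
  (forall n, (n0 <= n)%N -> exists i j,
     (m.-1 <= i < j)%N /\ (W i + W j = n * g)%N) ->
  asymptotically_complete m (fun n => W n.+1).
Proof.
move=> W_lt g_gt0 g_dvd m_ge2 pairs.
have W_mono i j : (i <= j)%N -> (W i <= W j)%N.
  by apply: (homo_leq (r := leq)) => // [|n]; [exact: leq_trans | exact: ltnW].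
split.
- by move=> i; apply: leq_ltn_trans (W_lt i).
- by move=> i j ij; apply: W_mono.
case: m m_ge2 pairs => [|[|m]] //= _ pairs.
exists g; split.
  split=> [i|e e_dvd]; first exact: g_dvd.
  have e_mul n : (n0 <= n)%N -> (e %| n * g)%N.
    move=> /pairs[i [j [/andP[mi ij] <-]]].
    case: i mi ij => // i _; case: j => // j _.
    by apply: dvdn_add; [exact: (e_dvd i) | exact: (e_dvd j)].
  rewrite -(dvdn_addr _ (e_mul n0 (leqnn n0))) addnC -mulSn.
  exact: e_mul.
pose V := (\sum_(j < m) W j.+1)%N.
have gV : (g %| V)%N.
  by apply: (big_ind (fun x => g %| x)%N) => // x y; exact: dvdn_add.
exists (n0 + V %/ g).+1%N => // n n_ge.
have [|i [j [/andP[mi ij] pair]]] := pairs (n - V %/ g)%N; first by lia.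
(* the term of index i is W i.+1, hence the predecessors *)
pose f (q : nat) := if (q < m)%N then q else if q == m then i.-1 else j.-1.
exists (fun q : 'I_m.+2 => f q).
  move=> q r; rewrite /f; have := ltn_ord r.
  by case: (ltnP q m); case: (ltnP r m); case: (eqVneq (q : nat) m);
    case: (eqVneq (r : nat) m); lia.
rewrite 2!big_ord_recr /= /f ltnn eqxx ltnNge leqnSn /= gtn_eqF //.
rewrite (eq_bigr (fun q : 'I_m => W q.+1)) => [|q _]; last by rewrite ltn_ord.
rewrite prednK ?prednK; try lia.
rewrite -/V -addnA pair mulnBl divnK // addnC subnK //.
rewrite -[X in (X <= _)%N](divnK gV) leq_mul2r; apply/orP; right; lia.
Qed.

Theorem theorem1p3 (d : measure_display) (T : measurableType d) (R : realType)
    (P : probability T R) (X : nat -> {RV P >-> nat})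
    (Xpos : forall (i : nat) (w : T), (0 < X i w)%N)
    (Xindep : mutually_independent X)
    (Xid : identically_distributed X)
    (Mradius : ((2 * theta (X 0%N))%:E < mgf_radius (X 0%N))%E)
    (m : nat) (hm : (2 <= m)%N) :
  {ae P, forall w : T,
    asymptotically_complete m (fun n => partial_sum X n.+1 w)}.
Proof.
have [rho [a [C [s [rho_a C_ge0 s_rate tail]]]]] :=
  exponential_rates (Xpos 0%N) Mradius.
have [rho_ge1 rho_lt] := andP rho_a.
have a_gt1 : 1 < a by apply: le_lt_trans rho_lt.
have a_gt0 : 0 < a by apply: lt_trans a_gt1.
have [g [y0 [L0 [kap [g_gt0 g_dvd kap01 likely]]]]] :=
  likely_paths (mass_ge0 (X 0%N)) (mass_le1 (X 0%N)) (mass0 (Xpos 0%N))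
    rho_ge1 s_rate.
have [l0 missed_le] := missed_prob Xpos Xindep Xid m.-1 rho_a C_ge0 kap01 tail
  g_dvd likely.
have z01 : 0 <= a^-1 < 1 by rewrite invr_ge0 ltW //= invf_lt1.
have c_ge0 : 0 <= (4 * C + 2) * a by apply: mulr_ge0; [lra | exact: ltW].
have eventually := ae_eventually_not c_ge0 z01 missed_le.
have in_support : {ae P, forall w, forall i, (g %| X i w)%N}.
  have : P.-negligible (\bigcup_i
      \bigcup_(s in [set s | mass (X 0%N) s = 0]) (X i @^-1` [set s])).
    apply: negligible_bigcup => i; rewrite bigcup_mkcond.
    apply: negligible_bigcup => x.
    case: ifP => [|_]; last exact: negligible_set0.
    rewrite inE /= => x0; apply/negligibleP; first exact: level_measurable.
    by have := mass_all Xid i x; rewrite x0.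
  apply: negligibleS => w /= /existsNP[i ndvd]; exists i => //.
  exists (X i w) => //=; apply: contra_notP ndvd => /eqP mass_neq0.
  by apply: g_dvd; rewrite lt_def mass_neq0 mass_ge0.
apply: filterS2 eventually in_support => w [l1 l1P] gX.
apply: (@complete_of_pairs (fun n => partial_sum X n w) g m
  (Num.truncn (a ^+ l1)).+1) => //.
- by move=> i; rewrite /partial_sum big_ord_recr /= -addn1 leq_add2l.
- move=> i; rewrite /partial_sum.
  by apply: (big_ind (fun x => g %| x)%N) => // x y; exact: dvdn_add.
move=> n n_ge.
have n_gt : a ^+ l1 <= (n * g)%:R.
  apply: le_trans (ltW (truncnS_gt _)) _; rewrite ler_nat.
  by apply: leq_trans n_ge _; exact: leq_pmulr.
have ng_gt0 : (0 < n * g)%N.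
  by rewrite muln_gt0 g_gt0 andbT; apply: leq_trans n_ge.
have [l l1l l_range] := block_index a_gt1 ng_gt0 n_gt.
apply: contrapT => no_pair; apply: (l1P l l1l).
exists (n * g)%N; split=> //; first exact: dvdn_mull.
Qed.
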